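(* For integers $1\le r\le n$ let $$T_r(n,q)=q^{r^2-r}\frac{(-q^{n-r+1};q)_r}{(-q;q)_r}\,{n-r+1\brack r}_q\, C_{n-r}(q).$$ Then $T_r(n,q)$ is a polynomial in $q$. If $n$ is even, $T_r(n,q)$ has only nonnegative coefficients. If $n$ is odd, $(1+q)T_r(n,q)$ has only nonnegative coefficients. Moreover, $T_r(2r-1,-q)$ has only nonnegative coefficients.
   Context: Notation: $[n]_q=1+q+\cdots+q^{n-1}$, $[n]_q!=[1]_q\cdots[n]_q$, $(x;q)_n=(1-x)(1-qx)\cdots(1-q^{n-1}x)$, ${m\brack k}_q=\frac{(q;q)_m}{(q;q)_k(q;q)_{m-k}}$ for $0\le k\le m$ and ${m\brack k}_q=0$ for $k>m\ge 0$, and $C_n(q)=\frac{1}{[n+1]_q}{2n\brack n}_q$ is the $q$-Catalan number. A polynomial is called positive if all its coefficients are nonnegative. *)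

(* Defs.v *)
From HB Require Import structures.
From mathcomp Require Import all_boot all_order all_algebra.
Set Implicit Arguments. Unset Strict Implicit. Unset Printing Implicit Defensive.
Import Order.TTheory GRing.Theory Num.Theory.
Local Open Scope ring_scope.

Notation qfrac := {fraction {poly rat}}.
Definition toF (p : {poly rat}) : qfrac := FracField.tofrac p.

Definition qint (n : nat) : {poly rat} := \sum_(i < n) 'X^i.

Definition qpoch (x : {poly rat}) (n : nat) : {poly rat} :=
  \prod_(i < n) (1 - 'X^i * x).

Definition qbinom (m k : nat) : qfrac :=
  if (k <= m)%N then
    toF (qpoch 'X m) / (toF (qpoch 'X k) * toF (qpoch 'X (m - k)))
  else 0.

Definition qcatalan (n : nat) : qfrac := qbinom (2 * n) n / toF (qint n.+1).

Definition T (r n : nat) : qfrac :=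
  toF ('X^(r * r - r)) * toF (qpoch (- 'X^(n - r + 1)) r) / toF (qpoch (- 'X) r)
  * qbinom (n - r + 1) r * qcatalan (n - r).

Definition poly_pos (p : {poly rat}) : Prop := forall i : nat, 0 <= p`_i.

(* Main.v *)
Require Import Defs.
From HB Require Import structures.
From mathcomp Require Import all_boot all_order all_algebra.
From mathcomp Require Import all_fingroup ring lra zify.
Set Implicit Arguments. Unset Strict Implicit. Unset Printing Implicit Defensive.
Import Order.TTheory GRing.Theory Num.Theory.
Local Open Scope ring_scope.

(* Put m = n - r and N = 2m + 1. Cancelling q-factorials gives, for r <= m + 1,
     [N]_q T_r(n, q) = q^(r^2 - r) F(q^2) A(q),
   where F = [n choose r] and A = [N choose n]. Let d = gcd(N, n). Then [N]
   divides A(q) [d], and since d is odd and prime to r, [d] divides F(q^2):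
   T is a polynomial.

   For positivity, consider the cone of symmetric unimodal polynomials of
   darga d (meaning p_i = p_(d-i)), generated by the q^j [d + 1 - 2j]. It is closed under products, it
   contains the Gaussian polynomials (sl_2 acts on exterior powers), and a
   polynomial p is positive as soon as [k]_q p lies in a cone. If n is odd,
   (1 + q) F(q^2) is symmetric unimodal, hence so is (1 + q) F(q^2) A. If n is
   even, use instead [n]_q T = q^(r^2 - r) F(q^2) [2m choose n-1], where
   [2m choose n-1] has odd darga, so that its blocks are (1 + q) times
   polynomials in q^2. If n = 2r - 1 then A = 1, and T is
   q^(r^2 - r) C(q^2) [n]_(-q) with C = F / [n] positive. *)

(** * Lowest weight vectors of sl_2 *)


(* With c = 2k - L < 0 one has X Y^(j+1) v = (j+1) (c - j) Y^j v, whose scalar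
   is nonzero: Y^(k+1) v = 0 forces Y^k v = 0, ..., v = 0. *)
Lemma sl2_raising_injective (V : lmodType rat) (X Y : V -> V)
    (W : nat -> V -> Prop) (L : nat)
    (X0 : X 0 = 0) (YZ : scalable Y)
    (Y0 : forall v, W 0%N v -> Y v = 0)
    (YS : forall k v, W k.+1 v -> W k (Y v))
    (XY : forall k v, W k v ->
       X (Y v) = Y (X v) + ((2 * k)%:R - L%:R) *: v) :
  forall k v, (2 * k < L)%N -> W k v -> X v = 0 -> v = 0.
Proof.
move=> k v kL Wv Xv.
have Y00 : Y 0 = 0 by have := YZ 0 0; rewrite !scale0r.
have WY j : (j <= k)%N -> W (k - j)%N (iter j Y v).
  elim: j => [|j IH] jk; first by rewrite subn0.
  by apply: YS; rewrite subnSK //; apply/IH/ltnW.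
have XYj j : (j <= k)%N ->
   X (iter j.+1 Y v) = (j.+1%:R * ((2 * k)%:R - L%:R - j%:R)) *: iter j Y v.
  elim: j => [|j IH] jk.
    by rewrite iterS (XY k) //= Xv Y00 add0r subr0 mul1r.
  rewrite iterS (XY _ _ (WY _ jk)) IH; last by rewrite ltnW.
  rewrite YZ -iterS -scalerDl; congr (_ *: _).
  have -> : (2 * (k - j.+1))%:R = (2 * k)%:R - (2 * j.+1)%:R :> rat.
    by rewrite -natrB ?leq_mul // mulnBr.
  by rewrite (natrM _ 2 j.+1) -(natr1 j.+1) -(natr1 j); ring.
suff H j : (j <= k.+1)%N -> iter (k.+1 - j) Y v = 0.
  by have := H k.+1 (leqnn _); rewrite subnn.
elim: j => [|j IH] jk.
  by rewrite subn0 iterS Y0 //; have := WY k (leqnn k); rewrite subnn.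
have jk' : (j <= k)%N by [].
have := XYj (k - j)%N (leq_subr _ _); rewrite -subSn // IH ?X0; last by rewrite ltnW.
rewrite subSS => /esym/eqP; rewrite scaler_eq0 => /orP[|/eqP //].
rewrite mulf_eq0 pnatr_eq0 subSn //= => /eqP h.
have : (2 * k)%:R < L%:R :> rat by rewrite ltr_nat.
have : 0 <= (k - j)%:R :> rat by [].
by move=> h1 h2; exfalso; clear -h h1 h2; lra.
Qed.

(** [M] is the matrix of [X] in the bases of indicator functions of points of [A] and of [B].
    Injectivity makes its #|A| rows independent, and they have #|B| entries. *)
Lemma leq_card_of_injective (T : finType) (A B : {set T})
    (X : {ffun T -> rat^o} -> {ffun T -> rat^o}) (linX : linear X)
    (XAB : forall v : {ffun T -> rat^o}, (forall t, v t != 0 -> t \in A) ->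
                     forall t, X v t != 0 -> t \in B)
    (injX : forall v : {ffun T -> rat^o},
       (forall t, v t != 0 -> t \in A) -> X v = 0 -> v = 0) :
  (#|A| <= #|B|)%N.
Proof.
pose d t : {ffun T -> rat^o} := [ffun s => (s == t)%:R].
pose M : 'M[rat]_(#|A|, #|B|) :=
  \matrix_(i, j) X (d (enum_val i)) (enum_val j).
have X0 : X 0 = 0.
  by have := linX (-1) 0 0; rewrite scaler0 addr0 scaleN1r addNr.
have Xsum n (c : 'I_n -> rat) (f : 'I_n -> {ffun T -> rat^o}) :
    X (\sum_i c i *: f i) = \sum_i c i *: X (f i).
  elim: n c f => [|n IH] c f; first by rewrite !big_ord0.
  by rewrite !big_ord_recl linX IH.
suff fM : row_free M by rewrite -(eqP fM) rank_leq_col.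
apply: inj_row_free => u uM.
pose v := \sum_i u 0 i *: d (enum_val i).
have vE i : v (enum_val i) = u 0 i.
  rewrite /v sum_ffunE (bigD1 i) //= big1 ?addr0 => [|j ji].
    by rewrite !ffunE eqxx; apply: mulr1.
  rewrite !ffunE (inj_eq enum_val_inj) eq_sym (negPf ji); exact: mulr0.
have vA t : v t != 0 -> t \in A.
  apply: contraR => tA; rewrite /v sum_ffunE big1 // => i _.
  rewrite !ffunE; case: eqP => [e|_]; last exact: mulr0.
  by move: tA; rewrite e enum_valP.
have Xv : X v = 0.
  apply/ffunP => t; rewrite ffunE; apply/eqP/negPn/negP => tn.
  have tB := XAB v vA t tn; move: tn; apply/negP/negPn/eqP.
  rewrite -(enum_rankK_in tB tB) Xsum sum_ffunE.
  have /matrixP/(_ 0 (enum_rank_in tB t)) := uM.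
  rewrite !mxE => h; rewrite -[RHS]h; apply: eq_bigr => i _.
  by rewrite ffunE mxE.
by apply/rowP => i; rewrite mxE -vE (injX v vA Xv) ffunE.
Qed.

(** * Moving an element of a subset *)


(** A transposition, rather than a removal followed by an insertion, makes the move an involution on
    all subsets without side conditions. *)
Definition swap (T : finType) (a b : T) (S : {set T}) : {set T} :=
  tperm a b @: S.

Lemma in_swap (T : finType) (a b x : T) (S : {set T}) :
  (x \in swap a b S) = (tperm a b x \in S).
Proof. by rewrite -{1}(tpermK a b x) mem_imset //; apply: perm_inj. Qed.

Lemma swapK (T : finType) (a b : T) : involutive (swap a b).
Proof. by move=> S; apply/setP => x; rewrite !in_swap tpermK. Qed.

Lemma swap_sym (T : finType) (a b : T) : swap a b =1 swap b a.
Proof. by move=> S; rewrite /swap tpermC. Qed.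

Lemma swap_comm (T : finType) (a b c d : T) (S : {set T}) :
  a != c -> a != d -> b != c -> b != d ->
  swap a b (swap c d S) = swap c d (swap a b S).
Proof.
move=> ac ad bc bd; apply/setP => x; rewrite !in_swap; congr (_ \in S).
have [->|xa] := eqVneq x a.
  by rewrite tpermL [tperm c d a]tpermD 1?eq_sym // tpermL tpermD // eq_sym.
have [->|xb] := eqVneq x b.
  by rewrite tpermR [tperm c d b]tpermD 1?eq_sym // tpermR tpermD // eq_sym.
rewrite [tperm a b x]tpermD 1?eq_sym //.
have [->|xc] := eqVneq x c; first by rewrite tpermL tpermD.
have [->|xd] := eqVneq x d; first by rewrite tpermR tpermD.
by rewrite tpermD 1?eq_sym // tpermD 1?eq_sym.
Qed.

(** Being a pullback, it acts on basis vectors in the opposite direction: the indicator of U goes to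
    that of U with [b] replaced by [a] if [b] is in U and [a] is not, and to 0 otherwise. *)
Definition hop (T : finType) (a b : T) (v : {ffun {set T} -> rat^o}) :
    {ffun {set T} -> rat^o} :=
  [ffun S : {set T} => if (a \in S) && (b \notin S) then v (swap a b S) else 0].

Lemma hop_linear (T : finType) (a b : T) : linear (hop a b).
Proof.
move=> c u v; apply/ffunP => S; rewrite !ffunE.
by case: ifP => _; rewrite // scaler0 addr0.
Qed.

Lemma hop_scale (T : finType) (a b : T) : scalable (hop a b).
Proof.
move=> c u; apply/ffunP => S; rewrite !ffunE.
by case: ifP => _; rewrite // scaler0.
Qed.

Lemma hop_sum (T : finType) (a b : T) (I : finType) (c : I -> rat)
    (f : I -> {ffun {set T} -> rat^o}) :
  hop a b (\sum_i c i *: f i) = \sum_i c i *: hop a b (f i).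
Proof.
apply/ffunP => S; rewrite ffunE !sum_ffunE.
case: ifP => h; first by apply: eq_bigr => i _; rewrite !ffunE h.
by rewrite big1 // => i _; rewrite !ffunE h scaler0.
Qed.

Lemma hop_hop (T : finType) (a b : T) (v : {ffun {set T} -> rat^o}) S :
  hop a b (hop b a v) S = if (a \in S) && (b \notin S) then v S else 0.
Proof.
rewrite !ffunE; case: ifP => // /andP[aS bS].
by rewrite !in_swap tpermL tpermR aS bS /= (swap_sym b a) swapK.
Qed.

Lemma hop_same_target (T : finType) (a b c : T) v :
  a != c -> hop a b (hop c b v) = 0.
Proof.
move=> ac; apply/ffunP => S; rewrite !ffunE.
by case: ifP => // /andP[aS bS]; rewrite !in_swap tpermR aS andbF.
Qed.

Lemma hop_same_source (T : finType) (a b c : T) v :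
  hop a b (hop a c v) = 0.
Proof.
apply/ffunP => S; rewrite !ffunE.
by case: ifP => // /andP[aS bS]; rewrite !in_swap tpermL (negPf bS).
Qed.

Lemma hop_comm (T : finType) (a b c d : T) v :
  a != c -> a != d -> b != c -> b != d ->
  hop a b (hop c d v) = hop c d (hop a b v).
Proof.
move=> ac ad bc bd; apply/ffunP => S; rewrite !ffunE !in_swap.
rewrite !tpermD // 1?eq_sym // (@swap_comm _ c d a b) // 1?eq_sym //.
by case: (a \in S); case: (b \in S); case: (c \in S); case: (d \in S).
Qed.

(** * Subsets of {0, ..., M} with given size and sum *)


Section SubsetSum.
Variable M : nat.
Implicit Types (S : {set 'I_M.+1}) (v : {ffun {set 'I_M.+1} -> rat^o}).

Definition subset_sum S : nat := \sum_(i in S) i.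

Lemma subset_sum_swap (a b : 'I_M.+1) S : a \in S -> b \notin S ->
  (subset_sum (swap a b S) + a = subset_sum S + b)%N.
Proof.
move=> aS bS; rewrite /subset_sum big_imset /=; last by move=> x y _ _ /perm_inj.
rewrite (bigD1 a) //= [in RHS](bigD1 a) //= tpermL.
rewrite (eq_bigr (fun i : 'I_M.+1 => i : nat)).
  by rewrite addnC [X in (_ + X)%N]addnC addnA.
move=> i /andP[iS ia]; rewrite tpermD // eq_sym //.
by apply: contraNneq bS => <-.
Qed.

Definition lo (i : 'I_M) : 'I_M.+1 := widen_ord (leqnSn M) i.
Definition hi (i : 'I_M) : 'I_M.+1 := lift ord0 i.

(* The action of x d/dy and y d/dx on the monomials x^i y^(M-i), extended to
   exterior powers; moves go between neighbours only, so no signs occur. *)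
Definition raising v := \sum_(i < M) (M - i)%:R *: hop (hi i) (lo i) v.
Definition lowering v := \sum_(i < M) i.+1%:R *: hop (lo i) (hi i) v.

(** The sets indexing a weight basis, for weight 2k - nM, in the [n]-th exterior power of the
    (M+1)-dimensional sl_2-module. *)
Definition level n k : {set {set 'I_M.+1}} :=
  [set S : {set 'I_M.+1} | (#|S| == n) && (subset_sum S == k)].

Lemma raising_linear : linear raising.
Proof.
move=> c u v; rewrite /raising scaler_sumr -big_split /=.
by apply: eq_bigr => i _; rewrite hop_linear scalerDr !scalerA mulrC.
Qed.

Lemma lowering_scale : scalable lowering.
Proof.
move=> c u; rewrite /lowering scaler_sumr.
by apply: eq_bigr => i _; rewrite hop_scale !scalerA mulrC.
Qed.

Lemma card_swap (a b : 'I_M.+1) S : #|swap a b S| = #|S|.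
Proof. by rewrite card_imset //; apply: perm_inj. Qed.

Lemma combination_support (c : 'I_M -> rat) (a b : 'I_M -> 'I_M.+1) v S :
  (\sum_(i < M) c i *: hop (a i) (b i) v) S != 0 ->
  exists i, [/\ a i \in S, b i \notin S & v (swap (a i) (b i) S) != 0].
Proof.
move=> h; suff /existsP[i /and3P[? ? ?]] :
    [exists i, [&& a i \in S, b i \notin S & v (swap (a i) (b i) S) != 0]].
  by exists i.
move: h; apply: contraR.
rewrite negb_exists => /forallP h; rewrite sum_ffunE big1 // => i _.
rewrite !ffunE; have := h i; case: ifP => [/andP[-> ->]|_ _]; last exact: scaler0.
by rewrite negbK => /eqP ->; exact: scaler0.
Qed.

Lemma lowering_level n k v :
  (forall S, v S != 0 -> S \in level n k.+1) ->
  forall S, lowering v S != 0 -> S \in level n k.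
Proof.
move=> vl S /combination_support[i [aS bS /vl]].
rewrite !inE card_swap => /andP[-> /=].
have := subset_sum_swap aS bS; rewrite /= /bump /= => h /eqP h'.
by apply/eqP; lia.
Qed.

Lemma raising_level n k v :
  (forall S, v S != 0 -> S \in level n k) ->
  forall S, raising v S != 0 -> S \in level n k.+1.
Proof.
move=> vl S /combination_support[i [aS bS /vl]].
rewrite !inE card_swap => /andP[-> /=].
have := subset_sum_swap aS bS; rewrite /= /bump /= => h /eqP h'.
by apply/eqP; lia.
Qed.

Lemma lowering_level0 n v :
  (forall S, v S != 0 -> S \in level n 0) -> lowering v = 0.
Proof.
move=> vl; apply/ffunP => S; rewrite [RHS]ffunE; apply/eqP/negPn/negP.
move=> /combination_support[i [aS bS /vl]].
rewrite !inE => /andP[_ /eqP h].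
by have := subset_sum_swap aS bS; rewrite h /= /bump /=; lia.
Qed.

(** The two moves involve four distinct points unless i and j are consecutive; then they share a
    source or a target and both compositions vanish. *)
Lemma hop_lo_hi_comm (i j : 'I_M) v : i != j ->
  hop (hi i) (lo i) (hop (lo j) (hi j) v) = hop (lo j) (hi j) (hop (hi i) (lo i) v).
Proof.
move=> ij; have ijn : (i != j :> nat) by [].
have ne (a b : 'I_M.+1) : (a != b :> nat) -> a != b by [].
have [e|e] := eqVneq (lo i) (hi j).
  have := congr1 val e; rewrite /= /bump /= => ev.
  rewrite e hop_same_target; last by apply: ne; rewrite /= /bump /=; lia.
  by rewrite -e hop_same_target //; apply: ne; rewrite /= /bump /=; lia.
have [e'|e'] := eqVneq (hi i) (lo j).
  by rewrite e' !hop_same_source.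
by rewrite hop_comm //; apply: ne; rewrite /= /bump /=; lia.
Qed.

(** In the commutator only the terms i = j survive. They act diagonally, and summation by parts
    turns their coefficients into the weight. *)
Lemma raising_lowering v S :
  raising (lowering v) S =
  lowering (raising v) S + (\sum_(i in S) ((2 * i)%:R - M%:R)) * v S.
Proof.
have eRL : raising (lowering v) =
    \sum_(i < M) \sum_(j < M)
      ((M - i)%:R * j.+1%:R) *: hop (hi i) (lo i) (hop (lo j) (hi j) v).
  apply: eq_bigr => i _; rewrite hop_sum scaler_sumr.
  by apply: eq_bigr => j _; rewrite scalerA.
have eLR : lowering (raising v) =
    \sum_(i < M) \sum_(j < M)
      ((M - i)%:R * j.+1%:R) *: hop (lo j) (hi j) (hop (hi i) (lo i) v).
  rewrite exchange_big; apply: eq_bigr => i _; rewrite hop_sum scaler_sumr.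
  by apply: eq_bigr => j _; rewrite scalerA mulrC.
apply/eqP; rewrite addrC -subr_eq; apply/eqP.
have -> : raising (lowering v) S - lowering (raising v) S =
   (raising (lowering v) - lowering (raising v)) S by rewrite !ffunE.
rewrite eRL eLR -sumrB sum_ffunE.
pose x (i : 'I_M.+1) : rat := (i \in S)%:R.
transitivity (\sum_(i < M) (M - i)%:R * i.+1%:R * (x (hi i) - x (lo i)) * v S).
  apply: eq_bigr => i _; rewrite -sumrB sum_ffunE (bigD1 i) //= big1 => [|j ji].
    have scaleB (c : rat) (A B : {ffun {set 'I_M.+1} -> rat^o}) :
      (c *: A - c *: B) S = c * (A S - B S) by rewrite -scalerBr !ffunE.
    rewrite addr0 scaleB !hop_hop /x.
    by case: (hi i \in S); case: (lo i \in S) => /=; ring.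
  by rewrite hop_lo_hi_comm 1?eq_sym // subrr ffunE.
rewrite -mulr_suml; congr (_ * _).
under eq_bigr do rewrite mulrBr.
rewrite sumrB [RHS]big_mkcond /=.
(* The coefficient of [x i] is i (M + 1 - i) - (i + 1) (M - i) = 2i - M; the added terms, [f] at 0
   and [g] at [M], vanish. *)
pose f (i : 'I_M.+1) : rat := (M.+1 - i)%:R * i%:R * x i.
pose g (i : 'I_M.+1) : rat := (M - i)%:R * i.+1%:R * x i.
transitivity (\sum_i f i - \sum_i g i).
  congr (_ - _).
    rewrite [RHS]big_ord_recl /f mulr0 mul0r add0r.
    by apply: eq_bigr => i _; rewrite /= /bump /= add1n subSS.
  by rewrite [RHS]big_ord_recr /= /g subnn !mul0r addr0.
rewrite -sumrB; apply: eq_bigr => i _; rewrite /f /g /x.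
case: ifP => _; last by rewrite !mulr0 subrr.
have iM : (i <= M)%N by rewrite -ltnS.
rewrite !natrB ?natrM -?natr1 //; first ring.
by rewrite ltnW.
Qed.

(** On functions supported on [level n k] the commutator is the scalar 2k - nM, so below the middle
    weight [raising] is injective into the next level. *)
Lemma card_level_unimodal n k : (2 * k < n * M)%N ->
  (#|level n k| <= #|level n k.+1|)%N.
Proof.
move=> kL; apply: (@leq_card_of_injective _ _ _ raising raising_linear).
  by move=> v vl t; apply: raising_level.
move=> v; apply: (sl2_raising_injective (Y := lowering)
  (W := fun k v => forall S, v S != 0 -> S \in level n k) (L := (n * M)%N)) => //.
- by have := raising_linear (-1) 0 0; rewrite scaler0 addr0 scaleN1r addNr.
- exact: lowering_scale.
- by move=> u; apply: lowering_level0.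
- by move=> l u; apply: lowering_level.
move=> l u ul; apply/ffunP => S; rewrite raising_lowering !ffunE.
congr (_ + _); have [->|/ul] := eqVneq (u S) 0; first by rewrite mulr0 scaler0.
rewrite inE => /andP[/eqP <- /eqP <-]; congr (_ * _).
rewrite sumrB sumr_const; congr (_ - _).
  by rewrite /subset_sum big_distrr /= natr_sum.
by rewrite natrM mulr_natl.
Qed.

(** The reflection i -> M - i exchanges the two levels. *)
Lemma card_level_rev n k : (k <= n * M)%N ->
  #|level n k| = #|level n (n * M - k)%N|.
Proof.
pose rv S : {set 'I_M.+1} := [set rev_ord i | i in S].
have sumrev S : (subset_sum (rv S) + subset_sum S = #|S| * M)%N.
  rewrite /subset_sum /rv big_imset /=; last by move=> x y _ _ /rev_ord_inj.
  rewrite -big_split /= -sum_nat_const; apply: eq_bigr => i _.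
  by have := ltn_ord i; lia.
have rvK : involutive rv.
  by move=> S; rewrite /rv -imset_comp (eq_imset _ (@rev_ordK _)) imset_id.
move=> kn; rewrite -(card_imset (level n k) (inv_inj rvK)).
apply: eq_card => S; apply/imsetP/idP.
  move=> [U]; rewrite !inE => /andP[/eqP cU /eqP sU] ->.
  rewrite card_imset ?cU ?eqxx; last exact: rev_ord_inj.
  by have := sumrev U; rewrite cU sU /= => h; apply/eqP; lia.
rewrite inE => /andP[/eqP cS /eqP sS].
exists (rv S); last by rewrite rvK.
rewrite !inE card_imset ?cS ?eqxx; last exact: rev_ord_inj.
have := sumrev S; rewrite cS sS => h; apply/eqP.
by apply: (@addIn (n * M - k)%N); rewrite h subnKC.
Qed.
End SubsetSum.

(** * Symmetric unimodal polynomials *)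


Lemma coef_qint n i : (qint n)`_i = (i < n)%:R.
Proof.
transitivity ((\poly_(j < n) (1 : rat))`_i); last by rewrite coef_poly; case: ifP.
rewrite poly_def /qint; congr (polyseq _)`_i.
by apply: eq_bigr => j _; rewrite scale1r.
Qed.

Lemma qintM n : (1 - 'X) * qint n = 1 - 'X^n.
Proof. by rewrite /qint -[RHS]opprB subrX1 -mulNr opprB. Qed.

Lemma one_subX_neq0 : (1 - 'X : {poly rat}) != 0.
Proof. by rewrite -opprB oppr_eq0 -polyC1 polyXsubC_eq0. Qed.

Lemma qintD a b : qint (a + b) = qint a + 'X^a * qint b.
Proof.
rewrite /qint big_split_ord /= mulr_sumr; congr (_ + _).
by apply: eq_bigr => i _; rewrite exprD.
Qed.

Lemma qintS n : qint n.+1 = 1 + 'X * qint n.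
Proof. by rewrite -add1n qintD /qint big_ord1. Qed.

Lemma qint_neq0 n : (0 < n)%N -> qint n != 0.
Proof.
by move=> n0; apply/eqP => /(congr1 (fun p : {poly rat} => p`_0)) /eqP;
  rewrite coef_qint n0 coef0 oner_eq0.
Qed.

(** Each block is q^j + ... + q^(d-j), the shifted character of an irreducible sl_2-module. Building
    the cone inductively reduces closure properties to single blocks. *)
Inductive symm_unimodal (d : nat) : {poly rat} -> Prop :=
| SU0 : symm_unimodal d 0
| SU_add_block c j p : 0 <= c -> (2 * j <= d)%N -> symm_unimodal d p ->
    symm_unimodal d (c *: ('X^j * qint (d.+1 - 2 * j)) + p).

Lemma SU_block d j : (2 * j <= d)%N -> symm_unimodal d ('X^j * qint (d.+1 - 2 * j)).
Proof.
by move=> jd; have := SU_add_block ler01 jd (SU0 d); rewrite scale1r addr0.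
Qed.

Lemma SU_add d p q :
  symm_unimodal d p -> symm_unimodal d q -> symm_unimodal d (p + q).
Proof.
move=> sp sq; elim: sp => [|c j p' c0 jd _ IH]; first by rewrite add0r.
by rewrite -addrA; apply: SU_add_block.
Qed.

Lemma SU_scale d c p : 0 <= c -> symm_unimodal d p -> symm_unimodal d (c *: p).
Proof.
move=> c0; elim=> [|a j q a0 jd _ IH]; first by rewrite scaler0; apply: SU0.
by rewrite scalerDr scalerA; apply: SU_add_block => //; apply: mulr_ge0.
Qed.

Lemma SU_shift d j p : symm_unimodal d p -> symm_unimodal (d + 2 * j) ('X^j * p).
Proof.
elim=> [|a i q a0 id _ IH]; first by rewrite mulr0; apply: SU0.
rewrite mulrDr -scalerAr mulrA -exprD.
rewrite (_ : d.+1 - 2 * i = (d + 2 * j).+1 - 2 * (j + i))%N; last by lia.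
by apply: SU_add_block => //; lia.
Qed.

(* One Clebsch-Gordan step is [a+1][b+1] = [a+b+1] + q [a][b]. *)
Lemma SU_qintM a b : symm_unimodal (a + b) (qint a.+1 * qint b.+1).
Proof.
elim: a b => [|a IH] b.
  have := @SU_block b 0; rewrite expr0 mul1r subn0 add0n.
  by rewrite {2}/qint big_ord1 expr0 mul1r; apply.
case: b => [|b].
  have := @SU_block a.+1 0; rewrite expr0 mul1r subn0 addn0.
  by rewrite {3}/qint big_ord1 expr0 mulr1; apply.
have -> : qint a.+2 * qint b.+2 =
    'X^0 * qint ((a.+1 + b.+1).+1 - 2 * 0) + 'X^1 * (qint a.+1 * qint b.+1).
  rewrite expr0 mul1r subn0 expr1.
  have -> : ((a.+1 + b.+1).+1 = b.+2 + a.+1)%N by lia.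
  rewrite qintD (qintS a.+1).
  have -> : qint b.+2 = qint b.+1 + 'X^(b.+1) by rewrite /qint big_ord_recr.
  by rewrite !exprS; ring.
apply: SU_add; first exact: SU_block.
rewrite (_ : a.+1 + b.+1 = a + b + 2 * 1)%N; last by lia.
exact: SU_shift.
Qed.

(** By bilinearity two blocks suffice; pulling out q^(i+j) leaves a product of two q-integers. *)
Lemma SU_mul d e p q :
  symm_unimodal d p -> symm_unimodal e q -> symm_unimodal (d + e) (p * q).
Proof.
move=> sp; elim=> [|b j q' b0 je _ IHq]; first by rewrite mulr0; apply: SU0.
rewrite mulrDr; apply: SU_add => //; rewrite -scalerAr; apply: SU_scale => //.
elim: sp => [|a i p' a0 id _ IHp]; first by rewrite mul0r; apply: SU0.
rewrite mulrDl; apply: SU_add => //; rewrite -scalerAl; apply: SU_scale => //.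
rewrite mulrACA -exprD.
rewrite (_ : d + e = (d - 2 * i) + (e - 2 * j) + 2 * (i + j))%N; last by lia.
by rewrite !subSn //; apply: SU_shift; apply: SU_qintM.
Qed.

Lemma qint_comp_double n : (1 + 'X) * (qint n \Po 'X^2) = qint (2 * n).
Proof.
apply: (mulfI one_subX_neq0); rewrite qintM mulrA.
have -> : (1 - 'X) * (1 + 'X) = (1 - 'X) \Po 'X^2 :> {poly rat}.
  by rewrite rmorphB /= comp_polyX rmorph1; ring.
by rewrite -rmorphM /= qintM rmorphB /= rmorph1 rmorphXn /= comp_polyX -exprM.
Qed.

(** The factor 1 + q fills the gaps left by q -> q^2: block j of darga d becomes block 2j of darga
    2d + 1. *)
Lemma SU_double d p : symm_unimodal d p ->
  symm_unimodal (2 * d).+1 ((1 + 'X) * (p \Po 'X^2)).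
Proof.
elim=> [|a j q a0 jd _ IH]; first by rewrite raddf0 mulr0; apply: SU0.
rewrite raddfD /= mulrDr; apply: SU_add => //.
rewrite linearZ /= -scalerAr; apply: SU_scale => //.
rewrite rmorphM /= mulrCA qint_comp_double rmorphXn /= comp_polyX -exprM.
rewrite (_ : 2 * (d.+1 - 2 * j) = (2 * d).+2 - 2 * (2 * j))%N; last by lia.
by apply: SU_block; lia.
Qed.

(* An odd-degree block is (1 + q) times an even polynomial. *)
Lemma SU_comp_mul d e p q : odd e ->
  symm_unimodal d p -> symm_unimodal e q ->
  symm_unimodal (2 * d + e) ((p \Po 'X^2) * q).
Proof.
move=> oe sp; elim=> [|b j q' b0 je _ IHq]; first by rewrite mulr0; apply: SU0.
rewrite mulrDr; apply: SU_add => //; rewrite -scalerAr; apply: SU_scale => //.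
pose h := (e./2 - j)%N.
have -> : (e.+1 - 2 * j = 2 * h.+1)%N by rewrite /h; lia.
rewrite -qint_comp_double.
have -> : (p \Po 'X^2) * ('X^j * ((1 + 'X) * (qint h.+1 \Po 'X^2))) =
   'X^j * ((1 + 'X) * ((p * qint h.+1) \Po 'X^2)) by rewrite rmorphM /=; ring.
rewrite (_ : 2 * d + e = (2 * (d + h)).+1 + 2 * j)%N; last by rewrite /h; lia.
apply/SU_shift/SU_double/SU_mul => //.
by have := @SU_block h 0; rewrite expr0 mul1r subn0; apply.
Qed.

Lemma coef_block d j i :
  ('X^j * qint (d.+1 - 2 * j))`_i = ((j <= i)%N && (i + j <= d)%N)%:R.
Proof.
rewrite coefXnM coef_qint; case: ltnP => ji //=; congr (nat_of_bool _)%:R; lia.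
Qed.

Lemma SU_coef0 d p : symm_unimodal d p -> 0 <= p`_0.
Proof.
elim=> [|a j q a0 jd _ IH]; first by rewrite coef0.
by rewrite coefD coefZ coef_block addr_ge0 // mulr_ge0.
Qed.

Lemma SU_coef_incr d p i : symm_unimodal d p -> (2 * i.+1 <= d)%N -> p`_i <= p`_i.+1.
Proof.
move=> + id; elim=> [|a j q a0 jd _ IH]; first by rewrite !coef0.
rewrite !coefD !coefZ !coef_block lerD // ler_wpM2l // ler_nat.
by case: (boolP ((j <= i)%N && _)) => // /andP[h1 h2]; rewrite lt0b; lia.
Qed.

Lemma SU_coef_decr d p i : symm_unimodal d p -> (d <= 2 * i + 1)%N -> p`_i.+1 <= p`_i.
Proof.
move=> + id; elim=> [|a j q a0 jd _ IH]; first by rewrite !coef0.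
rewrite !coefD !coefZ !coef_block lerD // ler_wpM2l // ler_nat.
by case: (boolP ((j <= i.+1)%N && _)) => // /andP[h1 h2]; rewrite lt0b; lia.
Qed.

(* (1 - q^n) p = (1 - q) P determines p_i from p_(i-n) and from p_(i+n):
   the first recursion gives positivity below the middle of P, the second
   above it. *)
Lemma SU_div_qint_pos d n p : (0 < n)%N -> symm_unimodal d (p * qint n) -> poly_pos p.
Proof.
case: n => // n _ sP; set P := p * qint n.+1 in sP.
have E : (1 - 'X^(n.+1)) * p = (1 - 'X) * P by rewrite -qintM /P; ring.
(* Coefficients of negative index count as 0, whence the case distinctions. *)
have rec i : p`_i - (if (i < n.+1)%N then 0 else p`_(i - n.+1)) =
    P`_i - (if i is j.+1 then P`_j else 0).
  have := congr1 (fun p : {poly rat} => p`_i) E.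
  rewrite /= !mulrBl !mul1r !coefB coefXnM coefXM => ->.
  by case: i.
have low i : (2 * i <= d)%N -> 0 <= p`_i.
  elim/ltn_ind: i => i IH id.
  have h1 : 0 <= (if (i < n.+1)%N then 0 else p`_(i - n.+1)).
    by case: ltnP => // ni; apply: IH; lia.
  have h2 : 0 <= P`_i - (if i is j.+1 then P`_j else 0).
    case: (i) id => [|j] jd; first by rewrite subr0 (SU_coef0 sP).
    by rewrite subr_ge0 (SU_coef_incr sP).
  by have := rec i; move: h1 h2; set a := (if _ then _ else _); set b := (P`_i - _); lra.
(* [m] bounds the distance from [i] up to the size of [p], so the induction descends from the zero
   coefficients beyond the degree. *)
have high m i : (size p <= i + m)%N -> (d < 2 * i.+1)%N -> 0 <= p`_i.
  elim/ltn_ind: m i => m IH i im di.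
  have [si|si] := leqP (size p) i; first by rewrite nth_default.
  have h1 : 0 <= p`_(i + n).+1 by apply: (IH (m - n.+1)%N); lia.
  have h2 : P`_(i + n).+1 <= P`_(i + n) by apply: (SU_coef_decr sP); lia.
  have := rec (i + n).+1; rewrite ltnS ltnNge leq_addl /= subSS addnK.
  by move: h1 h2; lra.
move=> i; have [h|h] := leqP (2 * i) d; first exact: low.
by apply: (high (size p)); lia.
Qed.

(** Block 0 gets weight p_0 and block j + 1 the increment p_(j+1) - p_j; these weights telescope
    back to the coefficients of p. *)
Lemma SU_of_coef d (p : {poly rat}) :
  (size p <= d.+1)%N ->
  (forall i, (i <= d)%N -> p`_i = p`_(d - i)) ->
  0 <= p`_0 ->
  (forall i, (2 * i < d)%N -> p`_i <= p`_i.+1) ->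
  symm_unimodal d p.
Proof.
move=> sp sym p0 inc.
have -> : p = p`_0 *: ('X^0 * qint (d.+1 - 2 * 0)) +
   \sum_(j < d./2) (p`_j.+1 - p`_j) *: ('X^(j.+1) * qint (d.+1 - 2 * j.+1)).
  apply/polyP => i; rewrite coefD coefZ coef_block coef_sum leq0n addn0 /=.
  under eq_bigr do rewrite coefZ coef_block.
  have [id|di] := leqP i d; last first.
    rewrite nth_default ?(leq_trans sp) // ?mulr0 add0r big1 // => j _.
    have -> : (i + j.+1 <= d)%N = false by lia.
    by rewrite andbF mulr0.
  (* [t] is [i] reflected into the lower half; the blocks containing q^i are those of index at most
     [t]. *)
  rewrite mulr1; pose t := minn i (d - i).
  have -> : p`_i = p`_t.
    rewrite /t; case: (leqP i (d - i)%N) => // _; exact: sym.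
  have td : (t <= d./2)%N by rewrite /t; lia.
  transitivity (p`_0 + \sum_(j < t) (p`_j.+1 - p`_j)).
    rewrite -(big_mkord xpredT (fun j => p`_j.+1 - p`_j)) telescope_sumr //.
    by rewrite addrC subrK.
  congr (_ + _); rewrite (big_ord_widen _ (fun j => p`_j.+1 - p`_j) td) big_mkcond.
  apply: eq_bigr => j _.
  have -> : (j.+1 <= i)%N && (i + j.+1 <= d)%N = (j < t)%N by rewrite /t; lia.
  by case: ifP; rewrite ?mulr1 ?mulr0.
apply: SU_add; first by apply: SU_scale => //; apply: SU_block.
apply: big_ind => [|x y|j _]; [exact: SU0|exact: SU_add|].
have jd : (2 * j.+1 <= d)%N by have := ltn_ord j; lia.
by apply: SU_scale; [rewrite subr_ge0 inc //; lia | apply: SU_block].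
Qed.

(** * Gaussian polynomials *)


(** The q-Pascal rule avoids division. Truncation of the exponent is harmless: when k' > m' the
    factor [gauss m' k'] is 0. *)
Fixpoint gauss (m k : nat) : {poly rat} :=
  match m, k with
  | _, 0 => 1
  | 0, _.+1 => 0
  | m'.+1, k'.+1 => 'X^(m' - k') * gauss m' k' + gauss m' k'.+1
  end.

Lemma gaussn0 m : gauss m 0 = 1.
Proof. by case: m. Qed.

Lemma gauss_small m k : (m < k)%N -> gauss m k = 0.
Proof.
elim: m k => [|m IH] [|k] //= mk.
by rewrite !IH ?mulr0 ?addr0 // ltnW.
Qed.

Lemma size_gauss m k : (size (gauss m k) <= (k * (m - k)).+1)%N.
Proof.
elim: m k => [|m IH] [|k] /=; rewrite ?size_poly1 ?size_poly0 //.
apply: (leq_trans (size_polyD _ _)); rewrite geq_max; apply/andP; split.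
  apply: (leq_trans (size_polyMleq _ _)); rewrite size_polyXn.
  by rewrite addSn /= subSS mulSn -addnS leq_add2l.
by apply: (leq_trans (IH _)); rewrite ltnS leq_mul2l subSS leq_sub2l // orbT.
Qed.

(** The finite q-binomial theorem: splitting off the last factor reproduces the q-Pascal rule. *)
Lemma gauss_gf N k :
  (\prod_(i < N) (('X^i)%:P * 'X + 1) : {poly {poly rat}})`_k =
  'X^('C(k, 2)) * gauss N k.
Proof.
elim: N k => [|N IH] k.
  rewrite big_ord0 coef1; case: k => [|k] /=; first by rewrite mulr1 expr0.
  by rewrite mulr0.
rewrite big_ord_recr /= mulrDr mulr1 coefD mulrA coefMX.
case: k => [|k] /=; first by rewrite add0r IH gaussn0.
rewrite coefMC !IH mulrDr mulrA -exprD mulrAC -exprD.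
have [kN|Nk] := leqP k N; last by rewrite gauss_small // !mulr0.
by congr ('X^_ * _ + _); rewrite binS bin1; lia.
Qed.

(** Expanding the product of the 1 + q^i y amounts to choosing the set of indices i that contribute.
    The shift 'C(k, 2) = 0 + 1 + ... + (k-1) is the least possible sum. *)
Lemma coef_gauss M k w :
  (gauss M.+1 k)`_w = #|level M k (w + 'C(k, 2))%N|%:R.
Proof.
have -> : (gauss M.+1 k)`_w = ('X^('C(k, 2)) * gauss M.+1 k)`_(w + 'C(k, 2)).
  by rewrite coefXnM ltnNge leq_addl addnK.
rewrite -gauss_gf bigA_distr coef_sum coef_sum /=.
rewrite -sum1_card natr_sum [RHS]big_mkcond; apply: eq_bigr => S _.
have -> : \prod_i (if i \in S then ('X^i)%:P * 'X else 1) =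
   ('X^(subset_sum S))%:P * 'X^#|S| :> {poly {poly rat}}.
  rewrite -big_mkcond big_split /= prodr_const -rmorph_prod; congr (_%:P * _).
  by rewrite /subset_sum; elim/big_rec2: _ => [//|i a b _ ->]; rewrite exprD.
rewrite coefCM coefXn inE; case: (eqVneq k #|S|) => [->|kS] /=.
  by rewrite mulr1 coefXn eq_sym; case: eqP.
by rewrite mulr0 coef0.
Qed.

Lemma gauss_symm_unimodal m k : (k <= m)%N ->
  symm_unimodal (k * (m - k)) (gauss m k).
Proof.
case: m => [|M].
  rewrite leqn0 => /eqP ->; have := @SU_block 0 0 isT.
  by rewrite expr0 mul1r /qint big_ord1 expr0.
move=> kM; have bin2E j : (2 * 'C(j, 2) + j = j * j)%N.
  by elim: j => // j IH; rewrite binS bin1 mulSn mulnS; lia.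
have {}bin2E := bin2E k.
(* Subtracting the shift turns the centre kM/2 of the subset sums into the centre k(M+1-k)/2 of the
   exponents. *)
have dE : (k * (M.+1 - k) + 2 * 'C(k, 2) = k * M)%N by rewrite mulnBr; nia.
apply: SU_of_coef.
- exact: size_gauss.
- move=> i id; rewrite !coef_gauss card_level_rev; last by lia.
  by congr (#|level _ _ _|%:R); lia.
- by rewrite coef_gauss.
move=> i id; rewrite !coef_gauss ler_nat addSn card_level_unimodal //; lia.
Qed.

(** * q-Pochhammer symbols and divisibility by q-integers *)

Lemma qpochS x n : qpoch x n.+1 = qpoch x n * (1 - 'X^n * x).
Proof. by rewrite /qpoch big_ord_recr. Qed.

Lemma qpochX_S n : qpoch 'X n.+1 = qpoch 'X n * (1 - 'X^(n.+1)).
Proof. by rewrite qpochS -exprSr. Qed.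

Lemma gauss_qpoch m k : (k <= m)%N ->
  gauss m k * (qpoch 'X k * qpoch 'X (m - k)) = qpoch 'X m.
Proof.
have q0 : qpoch 'X 0 = 1 by rewrite /qpoch big_ord0.
elim: m k => [|m IH] [|k] //= km; rewrite ?q0 ?mul1r ?subn0 //.
(* For k = m the second q-Pascal term is 0. Otherwise the two terms combine by q^(m-k) (1 - q^(k+1))
   + (1 - q^(m-k)) = 1 - q^(m+1). *)
rewrite subSS mulrDl; move: km; rewrite ltnS leq_eqVlt => /orP[/eqP ->|km].
  rewrite (gauss_small (ltnSn m)) mul0r addr0 subnn q0 expr0 !mul1r mulr1 !qpochX_S mulrA.
  by have := IH m (leqnn m); rewrite subnn q0 mulr1 => ->.
have h1 := IH k (ltnW km); have h2 := IH k.+1 km.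
have e : (m - k = (m - k.+1).+1)%N by lia.
rewrite [qpoch 'X m.+1]qpochX_S.
have -> : 'X^(m - k) * gauss m k * (qpoch 'X k.+1 * qpoch 'X (m - k)) =
    'X^(m - k) * (1 - 'X^(k.+1)) * qpoch 'X m by rewrite -h1 qpochX_S; ring.
have -> : gauss m k.+1 * (qpoch 'X k.+1 * qpoch 'X (m - k)) =
    (1 - 'X^(m - k)) * qpoch 'X m by rewrite -h2 e (qpochX_S (m - k.+1)); ring.
have -> : 'X^(m.+1) = 'X^(m - k) * 'X^(k.+1) :> {poly rat}.
  by rewrite -exprD; congr 'X^_; lia.
by ring.
Qed.

Arguments gauss : simpl never.

(** The factors pair as (1 - q^i)(1 + q^i) = 1 - q^(2i); this is how F(q^2) arises from the symbols
    (-q;q). *)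
Lemma qpoch_opp_comp r :
  qpoch 'X r * qpoch (- 'X) r = qpoch 'X r \Po 'X^2.
Proof.
elim: r => [|r IH]; first by rewrite /qpoch !big_ord0 mulr1 rmorph1.
rewrite !qpochS rmorphM /= -IH rmorphB rmorph1 rmorphM rmorphXn /= comp_polyX.
by rewrite exprAC; ring.
Qed.

Lemma qpoch_opp_cat m r :
  qpoch (- 'X) m * qpoch (- 'X^(m.+1)) r = qpoch (- 'X) (m + r).
Proof.
elim: r => [|r IH]; first by rewrite addn0 {2}/qpoch big_ord0 mulr1.
by rewrite addnS !qpochS mulrA IH !mulrN -exprD -exprSr addnS addnC.
Qed.

Lemma qpoch_neq0 n : qpoch 'X n != 0.
Proof.
elim: n => [|n IH]; first by rewrite /qpoch big_ord0 oner_eq0.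
by rewrite qpochX_S mulf_neq0 // -qintM mulf_neq0 ?one_subX_neq0 ?qint_neq0.
Qed.

Lemma qpoch_opp_neq0 n : qpoch (- 'X) n != 0.
Proof.
have : qpoch 'X n \Po 'X^2 != 0.
  by rewrite comp_poly_eq0 ?qpoch_neq0 // size_polyXn.
by rewrite -qpoch_opp_comp mulf_eq0 negb_or => /andP[].
Qed.

Lemma qbinomE m k : (k <= m)%N -> qbinom m k = toF (gauss m k).
Proof.
move=> km; rewrite /qbinom km -(gauss_qpoch km) /toF !rmorphM /= mulfK //.
by rewrite mulf_neq0 // tofrac_eq0 qpoch_neq0.
Qed.

(** The Euclidean algorithm on indices, through [b] = [b - a] + q^(b - a) [a]. The cofactor [g] lets
    it act on multiples such as A [N] and A [n]. *)
Lemma dvdp_qint_gcdn (p g : {poly rat}) a b :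
  p %| g * qint a -> p %| g * qint b -> p %| g * qint (gcdn a b).
Proof.
have [n] := ubnP (a + b); elim: n a b => // n IH a b.
wlog ab : a b / (a <= b)%N.
  move=> H; have [ab|ba] := leqP a b; first exact: H.
  by rewrite addnC gcdnC => h pa pb; apply: (H b a) => //; rewrite ltnW.
case: a ab => [|a] ab h pa pb; first by rewrite gcd0n.
have -> : gcdn a.+1 b = gcdn a.+1 (b - a.+1).
  by rewrite -{1}(subnK ab) gcdnDr.
apply: IH => //; first by lia.
move: pb; rewrite -{1}(subnK ab) qintD mulrDr dvdp_addl //.
by rewrite mulrCA dvdp_mull.
Qed.

(** For odd d one has (1 + q) [d]_(-q) = 1 + q^d, so the identity is 1 - q^(2d) = (1 - q^d)(1 + q^d)
    divided by 1 - q^2. *)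
Lemma qint_comp_sqr_odd d : odd d ->
  qint d \Po 'X^2 = qint d * (qint d \Po (- 'X)).
Proof.
move=> od.
have X1 : (1 + 'X : {poly rat}) != 0.
  by rewrite addrC -[1]opprK -polyC1 -polyCN polyXsubC_eq0.
apply: (mulfI X1); rewrite qint_comp_double.
apply: (mulfI one_subX_neq0); rewrite qintM.
have h : (1 + 'X) * (qint d \Po (- 'X)) = 1 + 'X^d.
  have := congr1 (fun p => p \Po (- 'X)) (qintM d).
  rewrite /= rmorphM !rmorphB !rmorph1 rmorphXn /= comp_polyX opprK => ->.
  by rewrite exprNn -signr_odd od expr1 mulN1r opprK.
transitivity ((1 - 'X) * qint d * ((1 + 'X) * (qint d \Po (- 'X)))); last by ring.
by rewrite h qintM mul2n -addnn exprD; ring.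
Qed.

Lemma gauss_absorb m k : (k <= m)%N ->
  gauss m.+1 k.+1 * qint k.+1 = qint m.+1 * gauss m k.
Proof.
move=> km.
have nz : (1 - 'X) * (qpoch 'X k * qpoch 'X (m - k)) != 0.
  by rewrite !mulf_neq0 ?one_subX_neq0 ?qpoch_neq0.
apply: (mulIf nz).
have h1 := gauss_qpoch km; have := @gauss_qpoch m.+1 k.+1 km.
rewrite subSS !qpochX_S -!qintM -h1 => h2.
transitivity (gauss m.+1 k.+1 *
   (qpoch 'X k * ((1 - 'X) * qint k.+1) * qpoch 'X (m - k))); first by ring.
by rewrite h2; ring.
Qed.

(** * The polynomials T_r(n, q) *)


Lemma dvdp_qint d n : (d %| n)%N -> qint d %| qint n.
Proof.
move=> /dvdnP[k ->]; elim: k => [|k IH]; first by rewrite /qint big_ord0 dvdp0.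
by rewrite mulSn qintD dvdp_addr // dvdp_mull.
Qed.

Lemma poly_posM p q : poly_pos p -> poly_pos q -> poly_pos (p * q).
Proof. by move=> hp hq i; rewrite coefM sumr_ge0 // => j _; rewrite mulr_ge0. Qed.

Lemma poly_pos_Xn e : poly_pos 'X^e.
Proof. by move=> i; rewrite coefXn ler0n. Qed.

Lemma poly_pos_comp_sqr p : poly_pos p -> poly_pos (p \Po 'X^2).
Proof. by move=> hp i; rewrite coef_comp_poly_Xn //; case: ifP. Qed.

Lemma poly_pos_qint n : poly_pos (qint n).
Proof. by move=> i; rewrite coef_qint ler0n. Qed.

(** The shape of [T]: [e] is the power of q, [a / b] the quotient of Pochhammer symbols, [c] the
    Gaussian polynomial and [g / f] the q-Catalan number. *)
Lemma frac_cancel (K : fieldType) (e a b c f g x : K) : b != 0 -> f != 0 ->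
  a * c * g = x * b * f -> e * a / b * c * (g / f) = e * x.
Proof.
move=> b0 f0 h; transitivity (e * (a * c * g) / (b * f)).
  by field; rewrite b0 f0.
by rewrite h; field; rewrite b0 f0.
Qed.

(** With n = m + r this is [N] T = q^(r^2 - r) F(q^2) A, cleared of denominators and without the
    power of q. *)
Lemma T_identity m r : (r <= m.+1)%N ->
  qpoch (- 'X^(m.+1)) r * gauss m.+1 r * gauss (2 * m) m * qint (2 * m).+1 =
  gauss (2 * m).+1 (m + r) * (gauss (m + r) r \Po 'X^2) *
    qpoch (- 'X) r * qint m.+1.
Proof.
move=> rm; set P := qpoch (- _) r; set A := gauss _ (m + r); set F := _ \Po _.
set g1 := gauss _ r; set g2 := gauss _ m.
(* These factors supply the denominators that let [hP], [hg1], [hg2], [hA] and [hF] turn both sides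
   into products of Pochhammer symbols and q-integers. *)
have nz : qpoch (- 'X) m * qpoch 'X r * qpoch 'X (m.+1 - r) * qpoch 'X m *
    qpoch 'X m * qpoch 'X (m + r) != 0.
  by rewrite !mulf_neq0 ?qpoch_neq0 ?qpoch_opp_neq0.
apply: (mulIf nz).
have hP : qpoch (- 'X) m * P = qpoch (- 'X) (m + r) := qpoch_opp_cat m r.
have hg1 : g1 * (qpoch 'X r * qpoch 'X (m.+1 - r)) =
    qpoch 'X m * ((1 - 'X) * qint m.+1).
  by rewrite gauss_qpoch // qpochX_S qintM.
have hg2 : g2 * (qpoch 'X m * qpoch 'X m) = qpoch 'X (2 * m).
  by rewrite -(@gauss_qpoch (2 * m) m) ?leq_pmull // [X in (X - _)%N]mul2n -addnn addnK.
have hA : A * (qpoch 'X (m + r) * qpoch 'X (m.+1 - r)) =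
    qpoch 'X (2 * m) * ((1 - 'X) * qint (2 * m).+1).
  rewrite qintM -qpochX_S -(@gauss_qpoch (2 * m).+1 (m + r)); last by lia.
  by congr (_ * (_ * qpoch _ _)); lia.
have hF : F * (qpoch 'X r * qpoch (- 'X) r * (qpoch 'X m * qpoch (- 'X) m)) =
    qpoch 'X (m + r) * qpoch (- 'X) (m + r).
  rewrite !qpoch_opp_comp -!rmorphM /=; congr (_ \Po _).
  by rewrite -(@gauss_qpoch (m + r) r) ?leq_addl // addnK.
transitivity ((qpoch (- 'X) m * P) * (g1 * (qpoch 'X r * qpoch 'X (m.+1 - r))) *
   (g2 * (qpoch 'X m * qpoch 'X m)) * qint (2 * m).+1 * qpoch 'X (m + r)).
  by ring.
rewrite hP hg1 hg2.
transitivity ((A * (qpoch 'X (m + r) * qpoch 'X (m.+1 - r))) *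
  (F * (qpoch 'X r * qpoch (- 'X) r * (qpoch 'X m * qpoch (- 'X) m))) *
  qint m.+1 * qpoch 'X m); last by ring.
by rewrite hA hF; ring.
Qed.

(** A common divisor of 2m + 1, m + r and r divides m, hence 1. *)
Lemma coprime_gcdn_r m r : (0 < r)%N -> coprime (gcdn (2 * m).+1 (m + r)) r.
Proof.
move=> r0; rewrite /coprime -dvdn1; set e := gcdn _ r.
have er : (e %| r)%N by apply: dvdn_gcdr.
have ed : (e %| gcdn (2 * m).+1 (m + r))%N by apply: dvdn_gcdl.
have em : (e %| m)%N.
  by rewrite -(dvdn_addl m er); apply: (dvdn_trans ed); apply: dvdn_gcdr.
rewrite -(@dvdn_addr (2 * m)) ?dvdn_mull // addn1.
by apply: (dvdn_trans ed); apply: dvdn_gcdl.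
Qed.

(** With F = [m+r choose r], [d] divides F [d], and also F [r] = [m+r] [m+r-1 choose r-1] because d
    divides m + r. Hence it divides F [gcd(d, r)] = F. *)
Lemma qint_gcdn_dvd_gauss m r : (0 < r)%N ->
  qint (gcdn (2 * m).+1 (m + r)) %| gauss (m + r) r.
Proof.
move=> r0; set d := gcdn _ _.
have cop : gcdn d r = 1%N by apply/eqP/coprime_gcdn_r.
rewrite -[gauss _ _]mulr1; have -> : 1 = qint (gcdn d r).
  by rewrite cop /qint big_ord1 expr0.
apply: dvdp_qint_gcdn; first by rewrite dvdp_mull.
case: r r0 @d cop => // r _ d _; rewrite addnS gauss_absorb ?leq_addl //.
by apply/dvdp_mulr/dvdp_qint; rewrite -addnS; apply: dvdn_gcdr.
Qed.

Lemma gauss_absorb_pred m r : (0 < r)%N -> (r <= m.+1)%N ->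
  gauss (2 * m).+1 (m + r) * qint (m + r) =
  qint (2 * m).+1 * gauss (2 * m) (m + r).-1.
Proof.
by case: r => // r _ rm; rewrite addnS gauss_absorb //; lia.
Qed.

Lemma qint_dvd_gauss_mul m r : (0 < r)%N -> (r <= m.+1)%N ->
  qint (2 * m).+1 %|
    gauss (2 * m).+1 (m + r) * (gauss (m + r) r \Po 'X^2).
Proof.
move=> r0 rm.
(* [N] divides A [N] and, by A [n] = [N] [2m choose n-1], also A [n]. *)
have hA : qint (2 * m).+1 %| gauss (2 * m).+1 (m + r) *
    qint (gcdn (2 * m).+1 (m + r)).
  apply: dvdp_qint_gcdn; first by rewrite dvdp_mull.
  by rewrite gauss_absorb_pred // dvdp_mulr.
have od : odd (gcdn (2 * m).+1 (m + r)).
  by apply: dvdn_odd (dvdn_gcdl _ _) _; rewrite /= mul2n odd_double.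
have /dvdpP[G ->] := qint_gcdn_dvd_gauss m r0.
rewrite rmorphM /= qint_comp_sqr_odd //.
by rewrite [(G \Po _) * _]mulrCA (mulrA (gauss _ _)); apply: dvdp_mulr.
Qed.

Theorem theorem4p2 (r n : nat) (hr : (1 <= r)%N) (hrn : (r <= n)%N) :
  exists p : {poly rat},
    T r n = toF p /\
    (~~ odd n -> poly_pos p) /\
    (odd n -> poly_pos ((1 + 'X) * p)) /\
    (n = (2 * r - 1)%N -> poly_pos (p \Po (- 'X))).
Proof.
pose m := (n - r)%N; have en : n = (m + r)%N by rewrite subnK.
(* For r > m + 1 the factor [m+1 choose r] of [T] is 0, so the polynomial is 0. *)
have [mr|rm] := ltnP m.+1 r.
  have pos0 : poly_pos 0 by move=> i; rewrite coef0.
  exists 0; rewrite mulr0 comp_poly0; split=> //.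
  rewrite /T -/m addn1 /qbinom [X in (if X then _ else _)]leqNgt mr /=.
  by rewrite mulr0 mul0r /toF rmorph0.
set N := (2 * m).+1; pose A := gauss N n; pose F := gauss n r \Po 'X^2.
have dvd : qint N %| A * F.
  by rewrite /A /F /N {1 2}en; apply: qint_dvd_gauss_mul.
pose p0 := (A * F) %/ qint N.
have p0E : p0 * qint N = A * F by rewrite divpK.
have qN : qint N != 0 by apply: qint_neq0.
have nN : (n <= N)%N by rewrite /N en; lia.
have n0 : (0 < n)%N by apply: leq_trans hrn.
have SUF : symm_unimodal (r * (n - r)) (gauss n r) by apply: gauss_symm_unimodal.
exists ('X^(r * r - r) * p0); split; last split; last split.
- rewrite /T -/m addn1 qbinomE //.
  rewrite /qcatalan qbinomE; last by lia.
  have := T_identity rm; rewrite -en -/N -/A -/F -p0E => idT.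
  have {idT} : qpoch (- 'X^(m.+1)) r * gauss m.+1 r * gauss (2 * m) m =
     p0 * qpoch (- 'X) r * qint m.+1.
    by apply: (mulIf qN); rewrite idT; ring.
  move=> /(congr1 toF); rewrite /toF !rmorphM /= => idT.
  by apply: frac_cancel idT; rewrite tofrac_eq0 ?qpoch_opp_neq0 ?qint_neq0.
- move=> en_even; apply: poly_posM; first exact: poly_pos_Xn.
  have e1 : p0 * qint n = F * gauss (2 * m) n.-1.
    apply: (mulIf qN); rewrite mulrAC p0E mulrAC /A {1 2}en.
    by rewrite gauss_absorb_pred // -en; ring.
  apply: (SU_div_qint_pos n0); rewrite e1; apply: SU_comp_mul SUF _; last first.
    by apply: gauss_symm_unimodal; lia.
  (* The darga is (n-1)(2m - (n-1)), and both factors are odd since n is even. *)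
  rewrite oddM oddB; last by lia.
  by rewrite mul2n odd_double; case: (n) n0 en_even => //= k _; rewrite negbK => ->.
- move=> _; rewrite mulrCA; apply: poly_posM; first exact: poly_pos_Xn.
  apply: (@SU_div_qint_pos _ N) => //; rewrite -mulrA p0E mulrCA mulrC.
  exact: SU_mul (SU_double SUF) (gauss_symm_unimodal nN).
move=> e2; have eN : N = n by rewrite /N; lia.
have on : odd n by rewrite -eN /N /= mul2n odd_double.
have qn : qint n != 0 by rewrite -eN.
have A1 : A = 1.
  apply: (mulIf (qpoch_neq0 n)); rewrite mul1r -[RHS](gauss_qpoch (leqnn n)).
  by rewrite subnn /A eN [qpoch 'X 0]big_ord0 mulr1.
have : qint n %| gauss n r.
  by have := qint_gcdn_dvd_gauss m hr; rewrite -/N -en eN gcdnn.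
case/dvdpP => G GE.
have posG : poly_pos G by apply: (SU_div_qint_pos n0); rewrite -GE; exact: SUF.
(* Here p0 [n] = F(q^2) = G(q^2) [n]_(q^2), and n is odd, so [n]_(q^2) = [n] [n]_(-q). *)
have -> : p0 = (G \Po 'X^2) * (qint n \Po (- 'X)).
  apply: (mulIf qn); rewrite -{1}eN p0E A1 mul1r /F GE rmorphM /=.
  by rewrite qint_comp_sqr_odd //; ring.
(* Under q -> -q the power of q is fixed, r^2 - r being even, G(q^2) is fixed too, and [n]_(-q)
   becomes [n]. *)
rewrite !rmorphM /= -!comp_polyA rmorphXn /= comp_polyX raddfN /= comp_polyX opprK.
rewrite comp_polyXr.
have -> : (- 'X) ^+ (r * r - r) = 'X^(r * r - r) :> {poly rat}.
  rewrite exprNn -signr_odd oddB; last by rewrite leq_pmulr.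
  by rewrite oddM andbb addbb expr0 mul1r.
have -> : 'X^2 \Po (- 'X) = 'X^2 :> {poly rat}.
  by rewrite rmorphXn /= comp_polyX sqrrN.
apply: poly_posM; first exact: poly_pos_Xn.
apply: poly_posM; [exact: poly_pos_comp_sqr|exact: poly_pos_qint].
Qed.
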